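(* Let $A$ be a (real or complex) Banach algebra and let $Q(A) := L(A)\setminus N'_3(A)$. Then the following hold: (1) $N'_3(A)$ is the component of the origin in $L(A)$. (2) $N'_3(A)$ is unbounded if it is not a singleton. (3) $L(A)$ is disconnected if and only if $Q(A) \neq \emptyset$. (4) If $Q(A)\neq\emptyset$, then $d(N'_3(A), Q(A)) \geq 1$.
   Context: Algebras are real or complex associative algebras, not assumed unital. $L(A) := \{ a \in A : axay = axy \ \text{for all } x,y \in A\}$ is the set of endomorphic left elements of $A$. $N'_3(A) := \{a \in A : axy = 0 \ \text{for all } x,y \in A\}$. For $U, V\subset A$, $d(U,V) := \inf_{x\in U,\, y\in V}\|x-y\|$. Components are connected components, with $L(A)$ carrying the relative norm topology. *)

(* Defs.v *)
From HB Require Import structures.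
From mathcomp Require Import all_boot all_order all_algebra.
From mathcomp Require Import all_classical all_reals all_analysis.
From mathcomp Require Import complex.

Set Implicit Arguments.
Unset Strict Implicit.
Unset Printing Implicit Defensive.

Import Order.TTheory GRing.Theory Num.Theory.
Import numFieldNormedType.Exports.

Local Open Scope classical_set_scope.
Local Open Scope ring_scope.

Variant scalar_kind := RealScalars | ComplexScalars.

Definition scalars (R : realType) (k : scalar_kind) : numFieldType :=
  match k with
  | RealScalars => R
  | ComplexScalars => R[i]
  end.

(* The norm of a normedModType over [R[i]] takes its values in [R[i]] (on the
   nonnegative real axis); [scalar_re] brings it back to [R]. *)
Definition scalar_re (R : realType) (k : scalar_kind) : scalars R k -> R :=
  match k with
  | RealScalars => fun x => x
  | ComplexScalars => fun z => complex.Re z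
  end.

(* MathComp rings all have a unit, so the product of a not necessarily unital
   algebra is a separate operation. *)
HB.mixin Record NormedModule_isBanachAlgebra (K : numFieldType) A
    of CompleteNormedModule K A := {
  bmul : A -> A -> A;
  bmulA : associative bmul;
  bmulDl : left_distributive bmul +%R;
  bmulDr : right_distributive bmul +%R;
  bmulZl : forall (c : K) (x y : A), bmul (c *: x) y = c *: bmul x y;
  bmulZr : forall (c : K) (x y : A), bmul x (c *: y) = c *: bmul x y;
  normr_bmul : forall x y : A, `|bmul x y| <= `|x| * `|y|
}.

#[short(type="banachAlgType")]
HB.structure Definition BanachAlgebra (K : numFieldType) :=
  {A of NormedModule_isBanachAlgebra K A & CompleteNormedModule K A}.

Declare Scope banach_scope.
Delimit Scope banach_scope with BA.
Notation "x ** y" := (bmul x y) (at level 40, left associativity)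
  : banach_scope.
Local Open Scope banach_scope.

Definition endoleft (K : numFieldType) (A : banachAlgType K) : set A :=
  [set a | forall x y : A, a ** x ** a ** y = a ** x ** y].
Arguments endoleft {K} A _.

Definition N'3 (K : numFieldType) (A : banachAlgType K) : set A :=
  [set a | forall x y : A, a ** x ** y = 0].
Arguments N'3 {K} A _.

Definition Qset (K : numFieldType) (A : banachAlgType K) : set A :=
  endoleft A `\` N'3 A.
Arguments Qset {K} A _.

(* As usual, the distance is [+oo] when one of the sets is empty. *)
Definition set_dist (R : realType) (k : scalar_kind)
    (A : normedModType (scalars R k)) (U V : set A) : \bar R :=
  ereal_inf [set (scalar_re `|x - y|)%:E | x in U & y in V].

(* Main.v *)
Require Import Defs.
From mathcomp Require Import all_boot all_order all_algebra.
From mathcomp Require Import all_classical all_reals all_analysis.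
From mathcomp Require Import complex.

(** Everything rests on a gap of width one between [N'3 A] and [Qset A].
    Let [a] be in [N'3 A], [b] in [endoleft A] and [c := b - a].  Applying the
    endomorphic identity of [b] to [x] and [y ** z], and using
    [a ** y ** z = 0], gives [b ** x ** (c ** y) ** z = b ** x ** y ** z]:
    between [b ** x] and a product, left multiplication by [c] is invisible
    ([endoleft_mulB_iter]).  It can thus be repeated [n] times, so that
    [`|b ** x ** y ** z| <= `|b| `|x| `|y| `|z| `|c| ^+ n] for all [n].  If
    [`|c| < 1], then every [b ** x ** y ** z] vanishes, hence so does
    [b ** x ** y = b ** x ** b ** y], and [b] is in [N'3 A].  So points of
    [N'3 A] and of [Qset A] are at distance at least one
    ([N'3_Qset_dist_ge1]).

    Consequently [N'3 A] and [Qset A], which cover [endoleft A], are separated: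
    a connected part of [endoleft A] lies in one of them.  Conversely [N'3 A]
    is stable under scaling, so it is a union of lines through the origin;
    this makes it connected, and unbounded unless it is reduced to [0]. *)

Import Order.TTheory GRing.Theory Num.Theory.
Import numFieldNormedType.Exports.

Local Open Scope classical_set_scope.
Local Open Scope ring_scope.
Local Open Scope banach_scope.

Definition real_scalar {R : realType} (k : scalar_kind) : R -> scalars R k :=
  match k with
  | RealScalars => fun x => x
  | ComplexScalars => fun x => x%:C%C
  end.

Lemma ge0_real_scalar_re {R : realType} {k : scalar_kind} {z : scalars R k} :
  0 <= z -> z = real_scalar k (scalar_re z).
Proof.
by case: k z => //= -[x y]; rewrite lecE /= => /andP[/eqP-> _].
Qed.

Lemma ler_real_scalar {R : realType} (k : scalar_kind) (x y : R) :
  (real_scalar k x <= real_scalar k y) = (x <= y).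
Proof. by case: k => //=; rewrite lecR. Qed.

Lemma real_scalarMX {R : realType} (k : scalar_kind) (x y : R) (n : nat) :
  real_scalar k (x * y ^+ n) = real_scalar k x * real_scalar k y ^+ n.
Proof. by case: k => //=; rewrite rmorphM rmorphXn. Qed.

Lemma real_scalar0 {R : realType} (k : scalar_kind) :
  real_scalar k (0 : R) = 0.
Proof. by case: k. Qed.

Lemma real_scalar1 {R : realType} (k : scalar_kind) :
  real_scalar k (1 : R) = 1.
Proof. by case: k. Qed.

Lemma continuous_real_scalar {R : realType} (k : scalar_kind) :
  continuous (@real_scalar R k).
Proof.
case: k => [|] t /=; first exact: cvg_id.
apply/(@cvgrPdist_lt _ _) => e e0.
have ee : e = (complex.Re e)%:C%C.
  exact: (@ge0_real_scalar_re R ComplexScalars e (ltW e0)).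
move: e0; rewrite ee ltcR => e0.
near=> s.
rewrite -rmorphB normc_def /= expr0n addr0 sqrtr_sqr ltcR.
near: s; exact: (@cvgr_dist_lt _ _ _ _ _ id t cvg_id).
Unshelve. all: by end_near.
Qed.

(** The scalars are archimedean, even though the complex ones are only
    partially ordered: all quantities compared here are nonnegative, hence
    real. *)
Lemma geometric_lower_bound_ge1 {R : realType} {k : scalar_kind}
    (r v M : scalars R k) :
  0 <= r -> 0 < v -> 0 <= M -> (forall n, v <= M * r ^+ n) -> 1 <= r.
Proof.
move=> r0 v0 M0 vMr.
have rE := ge0_real_scalar_re r0; have vE := ge0_real_scalar_re (ltW v0).
have ME := ge0_real_scalar_re M0.
move: (scalar_re r) (scalar_re v) (scalar_re M) rE vE ME => r' v' M' rE vE ME.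
have {}vMr n : v' <= M' * r' ^+ n.
  by rewrite -(ler_real_scalar k) real_scalarMX -rE -vE -ME.
have {}r0 : 0 <= r' by rewrite -(ler_real_scalar k) real_scalar0 -rE.
have {}v0 : 0 < v'.
  rewrite ltNge; apply/negP; rewrite -(ler_real_scalar k) real_scalar0 -vE.
  by move=> /(lt_le_trans v0); rewrite ltxx.
rewrite rE -(real_scalar1 k) ler_real_scalar leNgt; apply/negP => r1.
have : v' <= 0.
  have cv : (M' * r' ^+ n) @[n --> \oo] --> M' * 0.
    by apply: cvgMl_tmp; apply: cvg_expr; rewrite ger0_norm.
  rewrite mulr0 in cv.
  by apply: (cvgr_to_ge cv); near=> n.
by rewrite leNgt v0.
Unshelve. all: by end_near.
Qed.

Lemma separated_of_dist_ge {K : numFieldType} {V : normedModType K}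
    (U W : set V) (e : K) :
  0 < e -> (forall x y, U x -> W y -> e <= `|x - y|) -> separated U W.
Proof.
move=> e0 UWe; split; apply/seteqP; split => // x.
- move=> [/(_ _ (nbhsx_ballx x e e0))[y [Uy xy]] Wx].
  move: xy; rewrite -ball_normE /= distrC => /lt_geF.
  by rewrite UWe.
- move=> [Ux /(_ _ (nbhsx_ballx x e e0))[y [Wy xy]]].
  by move: xy; rewrite -ball_normE /= => /lt_geF; rewrite UWe.
Qed.

(** Such a set is the union of its lines through the origin.  Real scalars
    suffice to draw them, which leaves only the real line to be known to be
    connected. *)
Lemma connected_of_scaling {R : realType} {k : scalar_kind}
    {V : normedModType (scalars R k)} (S : set V) :
  (forall (t : scalars R k) x, S x -> S (t *: x)) -> connected S.
Proof.
move=> Sscale.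
have [->|/set0P[x0 Sx0]] := eqVneq S set0; first exact: connected0.
have -> : S = \bigcup_(x in S) [set real_scalar k t *: x | t in [set: R]].
  apply/seteqP; split=> [x Sx|_ [x Sx] [t _ <-]]; last exact: Sscale.
  by exists x => //; exists 1 => //; rewrite real_scalar1 scale1r.
apply: bigcup_connected.
  exists 0 => x Sx /=; exists 0 => //.
  by rewrite real_scalar0 scale0r.
move=> x Sx; apply: connected_continuous_connected.
  by apply/connected_intervalP.
apply: continuous_subspaceT => t.
exact: cvgZr_tmp (continuous_real_scalar k t).
Qed.

Lemma unbounded_of_scaling {K : numFieldType} {V : normedModType K}
    (S : set V) (a : V) :
  (forall (t : K) x, S x -> S (t *: x)) -> S a -> a != 0 -> ~ bounded_set S.
Proof.
move=> Sscale Sa a0 /= /pinfty_ex_gt0[M M0 SM].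
have := SM (((M + 1) / `|a|) *: a) (Sscale _ _ Sa); rewrite /= normrZ.
rewrite normrM normfV normr_id mulfVK ?normr_eq0//.
rewrite ger0_norm ?addr_ge0 ?ler01 ?(ltW M0)// => MM.
have : M < M + 1 by rewrite ltrDl.
by move=> /lt_le_trans /(_ MM); rewrite ltxx.
Qed.

Section BanachAlgebraProduct.
Context {K : numFieldType} {A : banachAlgType K}.
Implicit Types a b x y z : A.

Lemma bmul0l x : 0 ** x = 0.
Proof. by rewrite -(scale0r (0 : A)) bmulZl !scale0r. Qed.

Lemma bmul0r x : x ** 0 = 0.
Proof. by rewrite -(scale0r (0 : A)) bmulZr !scale0r. Qed.

Lemma bmulBl x y z : (x - y) ** z = x ** z - y ** z.
Proof. by rewrite bmulDl -scaleN1r bmulZl scaleN1r. Qed.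

Lemma bmulBr x y z : x ** (y - z) = x ** y - x ** z.
Proof. by rewrite bmulDr -scaleN1r bmulZr scaleN1r. Qed.

Lemma normr_iter_bmul_le c y n :
  `|iter n (bmul c) y| <= `|c| ^+ n * `|y|.
Proof.
elim: n => [|n IHn] /=; first by rewrite mul1r.
rewrite (le_trans (normr_bmul _ _))// exprS -mulrA.
by rewrite ler_wpM2l.
Qed.

Lemma N'3_0 : N'3 A 0.
Proof. by move=> x y; rewrite !bmul0l. Qed.

Lemma N'3_scale (t : K) x : N'3 A x -> N'3 A (t *: x).
Proof. by move=> Nx y z; rewrite !bmulZl Nx scaler0. Qed.

Lemma N'3_sub_endoleft : N'3 A `<=` endoleft A.
Proof. by move=> a Na x y; rewrite !Na bmul0l. Qed.

(** One step replaces [y] by [(b - a) ** y]: the [a] part is killed because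
    two factors follow it, and the [b] part is absorbed because [b ** x]
    precedes it. *)
Lemma endoleft_mulB_iter a b x y z n : N'3 A a -> endoleft A b ->
  b ** x ** iter n (bmul (b - a)) y ** z = b ** x ** y ** z.
Proof.
move=> Na Lb; elim: n => //= n; move: (iter n _ y) => u <-.
rewrite bmulBl bmulBr bmulBl -!bmulA (bmulA a) Na !bmul0r subr0.
(* The endomorphic identity is used with the product [u ** z] in last
   position. *)
by rewrite !bmulA -(bmulA _ u) Lb !bmulA.
Qed.

(** Membership in [Qset A] only says that some [b ** x ** y] is nonzero; the
    endomorphic identity lengthens it to [b ** x ** b ** y], so that a fourth
    factor is available for [endoleft_mulB_iter]. *)
Lemma Qset_mul_neq0 b : Qset A b -> exists x y z, b ** x ** y ** z != 0.
Proof.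
move=> [Lb Nb]; apply: contrapT => b0; apply: Nb => x y.
rewrite -Lb; apply/eqP/negPn/negP => bxby.
by apply: b0; exists x, b, y.
Qed.

End BanachAlgebraProduct.

Section Gap.
Context {R : realType} {k : scalar_kind} {A : banachAlgType (scalars R k)}.

Lemma N'3_Qset_dist_ge1 (a b : A) : N'3 A a -> Qset A b -> 1 <= `|a - b|.
Proof.
move=> Na Qb; have [x [y [z bxyz]]] := Qset_mul_neq0 b Qb.
rewrite distrC; set c := b - a.
apply: (@geometric_lower_bound_ge1 _ _ _ `|b ** x ** y ** z|
  (`|b ** x| * (`|y| * `|z|))) => [|||n].
- exact: normr_ge0.
- by rewrite normr_gt0.
- by rewrite !mulr_ge0.
rewrite -(endoleft_mulB_iter a b x y z n Na Qb.1) -/c -bmulA.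
rewrite (le_trans (normr_bmul _ _))// -mulrA ler_wpM2l//.
rewrite (le_trans (normr_bmul _ _))// mulrAC ler_wpM2r// mulrC.
exact: normr_iter_bmul_le.
Qed.

Lemma separated_N'3_Qset : separated (N'3 A) (Qset A).
Proof. exact: separated_of_dist_ge ltr01 N'3_Qset_dist_ge1. Qed.

Lemma connected_N'3 : connected (N'3 A).
Proof. by apply: connected_of_scaling => t x; exact: N'3_scale. Qed.

Lemma connected_sub_N'3 (C : set A) :
  C `<=` endoleft A -> C 0 -> connected C -> C `<=` N'3 A.
Proof.
move=> CL C0 Cconn.
have CNQ : C `<=` N'3 A `|` Qset A.
  move=> x /CL Lx; have [Nx|Nx] := pselect (N'3 A x); first by left.
  by right.
case: (connected_subset separated_N'3_Qset CNQ Cconn) => // /(_ 0 C0)[_ N0].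
by case: N0; exact: N'3_0.
Qed.

Lemma Qset_set_dist_ge1 : (1%:E <= set_dist (N'3 A) (Qset A))%E.
Proof.
apply: le_ereal_inf_tmp => _ [a Na [b Qb <-]].
rewrite lee_fin -(ler_real_scalar k) real_scalar1.
rewrite -ge0_real_scalar_re ?normr_ge0//.
exact: N'3_Qset_dist_ge1.
Qed.

End Gap.

Theorem theorem5p1 (R : realType) (k : scalar_kind)
    (A : banachAlgType (scalars R k)) :
  [/\ connected_component (endoleft A) 0 = N'3 A,
      (~ exists a : A, N'3 A = [set a]) -> ~ bounded_set (N'3 A),
      ~ connected (endoleft A) <-> Qset A !=set0 &
      Qset A !=set0 -> (1%:E <= set_dist (N'3 A) (Qset A))%E].
Proof.
have L0 : endoleft A 0 by apply: N'3_sub_endoleft; exact: N'3_0.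
split.
- apply/seteqP; split.
    apply: connected_sub_N'3.
    + exact: connected_component_sub.
    + exact: connected_component_refl.
    + exact: component_connected.
  apply: connected_component_max.
  + exact: N'3_0.
  + exact: N'3_sub_endoleft.
  + exact: connected_N'3.
- move=> N1.
  have [a [Na a0]] : exists a, N'3 A a /\ a != 0.
    apply: contrapT => N0; apply: N1; exists 0; apply/seteqP.
    split=> [x Nx /=|_ ->]; last exact: N'3_0.
    by apply/eqP/negPn/negP => x0; apply: N0; exists x.
  by apply: unbounded_of_scaling Na a0 => t x; exact: N'3_scale.
- split=> [Lconn|[b [Lb Nb]] Lconn].
    apply/set0P/eqP => Q0; apply: Lconn.
    suff -> : endoleft A = N'3 A by exact: connected_N'3.
    apply/seteqP; split; last exact: N'3_sub_endoleft.
    by rewrite -setD_eq0.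
  exact: Nb (connected_sub_N'3 _ (@subset_refl _ _) L0 Lconn _ Lb).
- by move=> _; exact: Qset_set_dist_ge1.
Qed.
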